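(* Let $d\in\{2,3\}$ and let $E>0$ be fixed, $\kappa=\sqrt E$. Let $\nu=\sum_{j=1}^{n}\delta_{\alpha_j}(x-y_j)$ and $\tilde\nu=\sum_{j=1}^{\tilde n}\delta_{\tilde\alpha_j}(x-\tilde y_j)$ be two multipoint potentials of Bethe–Peierls–Thomas–Fermi type in $\mathbb{R}^d$ (with $\alpha_j,\tilde\alpha_j\in\mathbb{C}$, with $y_1,\dots,y_n\in\mathbb{R}^d$ mutually distinct and $\tilde y_1,\dots,\tilde y_{\tilde n}\in\mathbb{R}^d$ mutually distinct), whose matrices $A(\kappa)$ and $\tilde A(\kappa)$ satisfy $\det A(\kappa)\neq 0$ and $\det\tilde A(\kappa)\neq0$. Let $f^+$ and $\tilde f^+$ be their scattering amplitudes at energy $E$. If $f^+(k,l)=\tilde f^+(k,l)$ for all $k,l\in\mathbb{S}^{d-1}_\kappa$, then $\nu=\tilde\nu$, i.e. $\{(y_j,\alpha_j):1\le j\le n\}=\{(\tilde y_j,\tilde\alpha_j):1\le j\le\tilde n\}$ (in particular $n=\tilde n$).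
   Context: Notation: $\mathbb{S}^{d-1}_\kappa=\{x\in\mathbb{R}^d:|x|=\kappa\}$. Multipoint potentials. A multipoint potential of Bethe–Peierls–Thomas–Fermi type in $\mathbb{R}^d$, $d=2,3$, is a formal sum $\nu(x)=\sum_{j=1}^n\delta_{\alpha_j}(x-y_j)$, $\alpha_j\in\mathbb{C}$, $y_j\in\mathbb{R}^d$ mutually distinct; it is identified with the finite set of pairs $\{(y_j,\alpha_j)\}$. The case $\nu\equiv0$ is the case $n=0$. A function $\psi$ solves $-\Delta\psi+\nu\psi=E\psi$ if $-\Delta\psi=E\psi$ on $\mathbb{R}^d\setminus\{y_1,\dots,y_n\}$ and, as $x\to y_j$: for $d=2$, $\psi(x)=\psi_{j,-1}\ln|x-y_j|+\psi_{j,0}+O(|x-y_j|)$ with $\psi_{j,0}=(-2\pi\alpha_j-\ln2+\gamma)\psi_{j,-1}$ ($\gamma$ is Euler's constant); for $d=3$, $\psi(x)=\psi_{j,-1}/|x-y_j|+\psi_{j,0}+O(|x-y_j|)$ with $4\pi\alpha_j\psi_{j,-1}=\psi_{j,0}$. Scattering amplitude. Let $\kappa=\sqrt E>0$. For $k\in\mathbb{S}^{d-1}_\kappa$ the scattering eigenfunction is the solution $\psi^+(x,k)=e^{ik\cdot x}+\psi^{sc}(x,k)$ with $|x|^{(d-1)/2}(\partial_{|x|}-i\kappa)\psi^{sc}\to0$ as $|x|\to\infty$ uniformly in $x/|x|$, and the scattering amplitude $f^+$ on $\mathbb{S}^{d-1}_\kappa\times\mathbb{S}^{d-1}_\kappa$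 is defined by $\psi^{sc}(x,k)=\frac{e^{i\kappa|x|}}{|x|^{(d-1)/2}}f^+(k,\kappa x/|x|)+O(|x|^{-(d+1)/2})$. Explicitly (these known formulas may be taken as the definition of $\psi^+$ and $f^+$): let $$G^+(x,\kappa)=-\tfrac i4H_0^1(\kappa|x|)\ (d=2),\qquad G^+(x,\kappa)=-\frac{e^{i\kappa|x|}}{4\pi|x|}\ (d=3),$$ where $H_0^1$ is the zeroth-order Hankel function of the first kind. Let $A(\kappa)$ be the $n\times n$ matrix with $A_{j,j}(\kappa)=\alpha_j-\frac1{4\pi}(\pi i-2\ln\kappa)$ if $d=2$, $A_{j,j}(\kappa)=\alpha_j-\frac{i\kappa}{4\pi}$ if $d=3$, and $A_{j,j'}(\kappa)=G^+(y_j-y_{j'},\kappa)$ for $j\ne j'$. Assuming $\det A(\kappa)\ne0$ (for $n=0$ this condition is void), let $q(k)=(q_1(k),\dots,q_n(k))^t$ be the solution of $A(\kappa)q(k)=-(e^{ik\cdot y_1},\dots,e^{ik\cdot y_n})^t$. Then, for $k,l\in\mathbb{S}^{d-1}_\kappa$, $$\psi^+(x,k)=e^{ik\cdot x}+\sum_{j=1}^nq_j(k)G^+(x-y_j,\kappa),\qquad f^+(k,l)=\frac{c(d,\kappa)}{(2\pi)^d}\sum_{j=1}^nq_j(k)e^{-il\cdot y_j},$$ with $c(d,\kappa)=-\pi i(\sqrt{2\pi}e^{-i\pi/4})^{d-1}\kappa^{(d-3)/2}$. For $\tilde\nu$ the objects $\tilde A,\tilde q,\tilde f^+$ are defined in the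 same way from $\tilde n,\tilde\alpha_j,\tilde y_j$. *)

(* Defs.v *)
From HB Require Import structures.
From mathcomp Require Import all_boot all_order all_algebra.
From mathcomp Require Import all_classical all_reals all_analysis.
From mathcomp Require Import complex.

Set Implicit Arguments.
Unset Strict Implicit.
Unset Printing Implicit Defensive.
Import Order.TTheory GRing.Theory Num.Theory numFieldNormedType.Exports.

Local Open Scope classical_set_scope.
Local Open Scope ring_scope.
Local Open Scope complex_scope.

Section Defs.
Variable R : realType.

Definition expi (t : R) : R[i] := cos t +i* sin t.

Definition dotv (d : nat) (x y : 'rV[R]_d) : R := \sum_(i < d) x 0 i * y 0 i.

(* The library norm on matrices is the sup norm, not the Euclidean one. *)
Definition enorm (d : nat) (x : 'rV[R]_d) : R := Num.sqrt (dotv x x).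

Definition esphere (d : nat) (kappa : R) : set 'rV[R]_d :=
  [set x | enorm x = kappa].

(* [series harmonic m] is 1 + 1/2 + ... + 1/m. *)
Definition euler_gamma : R := limn (fun m : nat => series harmonic m - ln m%:R).

Definition besselJ0 (x : R) : R :=
  limn (series (fun m : nat => (-1) ^+ m * (x / 2) ^+ m.*2 / (m`!)%:R ^+ 2)).

(* Meaningful for 0 < x only; the m = 0 term of the series vanishes. *)
Definition besselY0 (x : R) : R :=
  2 / pi * ((ln (x / 2) + euler_gamma) * besselJ0 x
    - limn (series (fun m : nat =>
        (-1) ^+ m * series harmonic m * (x / 2) ^+ m.*2 / (m`!)%:R ^+ 2))).

Definition hankel0 (x : R) : R[i] := besselJ0 x +i* besselY0 x.

(* In this definition and the following ones, only d = 2 and d = 3 are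
   meaningful: every d other than 2 is given the formula for d = 3. *)
Definition Gplus (d : nat) (kappa : R) (x : 'rV[R]_d) : R[i] :=
  if d == 2%N then - ((4^-1) *i) * hankel0 (kappa * enorm x)
  else - expi (kappa * enorm x) / (4 * pi * enorm x)%:C.

(* A multipoint potential is given by its points y_j and strengths alpha_j;
   as an object it is the set of pairs (y_j, alpha_j). *)
Definition potential (d n : nat) (y : 'I_n -> 'rV[R]_d) (alpha : 'I_n -> R[i]) :
    set ('rV[R]_d * R[i]) :=
  range (fun j => (y j, alpha j)).

Definition scatA (d n : nat) (y : 'I_n -> 'rV[R]_d) (alpha : 'I_n -> R[i])
    (kappa : R) : 'M[R[i]]_n :=
  \matrix_(j, j')
    if j == j' then
      if d == 2%N then alpha j - ((4 * pi)^-1)%:C * (pi *i - (2 * ln kappa)%:C)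
      else alpha j - (kappa / (4 * pi)) *i
    else Gplus kappa (y j - y j').

(* The solution q of A q = - (e^{i k . y_j})_j, for A invertible. *)
Definition scatq (d n : nat) (y : 'I_n -> 'rV[R]_d) (alpha : 'I_n -> R[i])
    (kappa : R) (k : 'rV[R]_d) : 'cV[R[i]]_n :=
  invmx (scatA y alpha kappa) *m - (\col_j expi (dotv k (y j))).

Definition scatc (d : nat) (kappa : R) : R[i] :=
  - (pi *i) * ((Num.sqrt (2 * pi))%:C * expi (- (pi / 4))) ^+ d.-1
    * (kappa `^ ((d%:R - 3) / 2))%:C.

Definition scat_amplitude (d n : nat) (y : 'I_n -> 'rV[R]_d)
    (alpha : 'I_n -> R[i]) (kappa : R) (k l : 'rV[R]_d) : R[i] :=
  scatc d kappa / ((2 * pi) ^+ d)%:C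
  * \sum_(j < n) scatq y alpha kappa k j 0 * expi (- dotv l (y j)).

End Defs.

(* Main.v *)
Require Import Defs.
From mathcomp Require Import all_boot all_order all_algebra.
From mathcomp Require Import all_classical all_reals all_analysis.
From mathcomp Require Import complex zify ring.
Import Order.TTheory GRing.Theory Num.Theory numFieldNormedType.Exports.
Local Open Scope classical_set_scope.
Local Open Scope ring_scope.
Local Open Scope complex_scope.

(* The amplitude f^+(k, l) is, up to a nonzero constant, the form in plane waves
   e^{-i l.y_i} e^{i k.y_j} with coefficient matrix A^{-1}.  Plane waves with
   distinct frequencies are linearly independent on the sphere, so f^+ determines
   which (y_i, y_j) carry which entry of A^{-1}; as A^{-1} has no zero row, this
   gives the points, then A, and the strengths from the diagonal of A.

   For the independence, restrict to a great circle on which the frequencies stay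
   distinct.  With w = e^{it}, each wave e satisfies w e' = (a w^2 + b) e with
   distinct constants a, so a relation with coefficients polynomial in w can be
   combined with its derivative to eliminate a term; comparing degrees shows that
   the other coefficients stay nonzero. *)

(** * Calculus of complex-valued functions of a real variable *)

Section ComplexDerivative.
Set Implicit Arguments.
Unset Strict Implicit.
Context {R : realType}.
Implicit Types (f g : R -> R[i]) (c t : R).

(** Componentwise, so that the real rules for cosine and sine carry over. *)
Definition is_cderive f f' : Prop := forall t,
  is_derive t 1 (fun s => complex.Re (f s)) (complex.Re (f' t)) /\
  is_derive t 1 (fun s => complex.Im (f s)) (complex.Im (f' t)).

Lemma complexReD (x y : R[i]) : complex.Re (x + y) = complex.Re x + complex.Re y.
Proof. by case: x y => [? ?] []. Qed.

Lemma complexImD (x y : R[i]) : complex.Im (x + y) = complex.Im x + complex.Im y.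
Proof. by case: x y => [? ?] []. Qed.

Lemma complexReM (x y : R[i]) :
  complex.Re (x * y) = complex.Re x * complex.Re y - complex.Im x * complex.Im y.
Proof. by case: x y => [? ?] []. Qed.

Lemma complexImM (x y : R[i]) :
  complex.Im (x * y) = complex.Re x * complex.Im y + complex.Im x * complex.Re y.
Proof. by case: x y => [? ?] []. Qed.

Lemma is_cderive_ext f f' g g' :
  is_cderive f f' -> f =1 g -> f' =1 g' -> is_cderive g g'.
Proof. by move=> df /funext <- /funext <-. Qed.

Lemma is_cderive_cst (x : R[i]) : is_cderive (fun=> x) (fun=> 0).
Proof. by move=> t; split; apply: is_derive_cst. Qed.

Lemma is_cderiveD f g f' g' : is_cderive f f' -> is_cderive g g' ->
  is_cderive (fun t => f t + g t) (fun t => f' t + g' t).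
Proof.
move=> df dg t; have [df1 df2] := df t; have [dg1 dg2] := dg t.
by split; [rewrite complexReD; under eq_fun do rewrite complexReD
  |rewrite complexImD; under eq_fun do rewrite complexImD]; apply: is_deriveD.
Qed.

Lemma is_cderiveM f g f' g' : is_cderive f f' -> is_cderive g g' ->
  is_cderive (fun t => f t * g t) (fun t => f' t * g t + f t * g' t).
Proof.
move=> df dg t; have [df1 df2] := df t; have [dg1 dg2] := dg t.
split.
- under eq_fun do rewrite complexReM.
  apply: is_derive_eq (is_deriveB (is_deriveM df1 dg1) (is_deriveM df2 dg2)) _.
  by rewrite complexReD !complexReM /GRing.scale /=; ring.
- under eq_fun do rewrite complexImM.
  apply: is_derive_eq (is_deriveD (is_deriveM df1 dg2) (is_deriveM df2 dg1)) _.
  by rewrite complexImD !complexImM /GRing.scale /=; ring.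
Qed.

Lemma is_cderive_sum (T : Type) (s : seq T) (f f' : T -> R -> R[i]) :
  (forall z, is_cderive (f z) (f' z)) ->
  is_cderive (fun t => \sum_(z <- s) f z t) (fun t => \sum_(z <- s) f' z t).
Proof.
move=> df; elim: s => [|z s IH].
  by apply: is_cderive_ext (is_cderive_cst 0) _ _ => t; rewrite big_nil.
by apply: is_cderive_ext (is_cderiveD (df z) IH) _ _ => t; rewrite big_cons.
Qed.

Lemma is_cderive_unique f f' g' : is_cderive f f' -> is_cderive f g' -> f' =1 g'.
Proof.
move=> d1 d2 t; have [a1 b1] := d1 t; have [a2 b2] := d2 t.
apply/eqP; rewrite eq_complex.
by rewrite -(@derive_val _ _ _ _ _ _ _ a1) -(@derive_val _ _ _ _ _ _ _ b1)
  (@derive_val _ _ _ _ _ _ _ a2) (@derive_val _ _ _ _ _ _ _ b2) !eqxx.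
Qed.

Lemma is_cderive_expi (g g' : R -> R) : (forall t, is_derive t 1 g (g' t)) ->
  is_cderive (fun t => expi (g t)) (fun t => (g' t) *i * expi (g t)).
Proof.
move=> dg t; split => /=.
- have := @is_derive1_comp _ cos g t _ _ (is_derive_cos _) (dg t).
  by move=> h; apply: (is_derive_eq h); ring.
- have := @is_derive1_comp _ sin g t _ _ (is_derive_sin _) (dg t).
  by move=> h; apply: (is_derive_eq h); ring.
Qed.

Lemma is_cderive_horner (f f' : R -> R[i]) (p : {poly R[i]}) : is_cderive f f' ->
  is_cderive (fun t => p.[f t]) (fun t => f' t * p^`().[f t]).
Proof.
move=> df; elim/poly_ind: p => [|p c IH].
  by apply: is_cderive_ext (is_cderive_cst 0) _ _ => t;
    rewrite ?deriv0 horner0 ?mulr0.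
apply: is_cderive_ext (is_cderiveD (is_cderiveM IH df) (is_cderive_cst c)) _ _ => t.
  by rewrite hornerMXaddC.
by rewrite derivMXaddC !hornerE; ring.
Qed.

Lemma expiD (s t : R) : expi (s + t) = expi s * expi t.
Proof.
apply/eqP; rewrite eq_complex complexReM complexImM /= cosD sinD.
by rewrite [cos s * sin t + _]addrC !eqxx.
Qed.

Lemma expi0 : expi 0 = 1 :> R[i].
Proof. by rewrite /expi cos0 sin0. Qed.

Lemma expi_neq0 (t : R) : expi t != 0.
Proof.
apply/eqP => h; have := expiD t (- t).
by rewrite subrr h mul0r expi0 => /eqP; rewrite oner_eq0.
Qed.

Lemma poly_inj_roots_eq0 (K : idomainType) (p : {poly K}) (x : nat -> K) :
  injective x -> (forall k, p.[x k] = 0) -> p = 0.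
Proof.
move=> xinj hp; apply/eqP/negP => /negP p0.
suff : (size (mkseq x (size p)) < size p)%N by rewrite size_mkseq ltnn.
apply: max_poly_roots => //; last exact: mkseq_uniq.
by apply/allP => _ /mapP[k _ ->]; exact/rootP.
Qed.

(** The numbers 1/(k+1) lie in [0, pi], where cosine is injective, so they give infinitely many
    roots of [p]. *)
Lemma poly_expi_eq0 (p : {poly R[i]}) : (forall t : R, p.[expi t] = 0) -> p = 0.
Proof.
move=> hp; apply: (@poly_inj_roots_eq0 _ _ (fun k => expi (k.+1%:R^-1 : R))) => //.
have inI m : (m.+1%:R^-1 : R) \in `[0, pi].
  rewrite in_itv /= invr_ge0 ler0n /= (le_trans _ (@pi_ge2 R)) //.
  by rewrite (@le_trans _ _ 1) ?invf_le1 ?ltr0n ?ler1n // ler1n.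
move=> k l [h _]; have /invr_inj/eqP := cos_inj (inI k) (inI l) h.
by rewrite eqr_nat eqSS => /eqP.
Qed.

End ComplexDerivative.

(** * Independence of exponentials over polynomials in e^{it} *)

Section Independence.
Set Implicit Arguments.
Unset Strict Implicit.
Context {R : realType}.

(* If [expi t * e' = (a * expi t ^+ 2 + b) * e], then
   [expi t * (p.[expi t] * e)' = (twisted_deriv a b p).[expi t] * e]. *)
Definition twisted_deriv (a b : R[i]) (p : {poly R[i]}) : {poly R[i]} :=
  'i%C%:P * 'X^2 * p^`() + (a%:P * 'X^2 + b%:P) * p.

Lemma horner_twisted_deriv (a b x : R[i]) (p : {poly R[i]}) :
  (twisted_deriv a b p).[x] = 'i%C * x ^+ 2 * p^`().[x] + (a * x ^+ 2 + b) * p.[x].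
Proof. by rewrite !(hornerXn, hornerC, hornerD, hornerM). Qed.

(* The leading terms cannot cancel: one side gains degree 2, the other at most 1. *)
Lemma twisted_deriv_wronskian_neq0 (a b a0 b0 : R[i]) (p p0 : {poly R[i]}) :
  a != a0 -> p != 0 -> p0 != 0 ->
  p0 * twisted_deriv a b p - p * twisted_deriv a0 b0 p0 != 0.
Proof.
move=> aa0 pn0 p0n0.
have pp : p0 * p != 0 by rewrite mulf_neq0.
set u := (a - a0)%:P * 'X^2 * (p0 * p).
set v := 'i%C%:P * 'X^2 * (p0 * p^`() - p * p0^`()) + (b - b0)%:P * (p0 * p).
have -> : p0 * twisted_deriv a b p - p * twisted_deriv a0 b0 p0 = u + v.
  by rewrite /twisted_deriv /u /v !polyCB; ring.
have szu : size u = (size (p0 * p)).+2.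
  by rewrite /u -mulrA size_Cmul ?subr_eq0 // mulrC size_mulXn.
have szW : (size (p0 * p^`() - p * p0^`())%R < size (p0 * p)%R)%N.
  have sp := lt_size_deriv pn0; have sp0 := lt_size_deriv p0n0.
  have spp : size (p0 * p) = (size p0 + size p)%N.-1 by rewrite size_mul.
  have m1 := size_polyMleq p0 p^`(); have m2 := size_polyMleq p p0^`().
  have n0 : (0 < size p)%N by rewrite size_poly_gt0.
  have n1 : (0 < size p0)%N by rewrite size_poly_gt0.
  rewrite (leq_ltn_trans (size_polyD _ _)) // size_polyN gtn_max spp.
  have lt_pred m n k : (0 < m -> k < n -> (m + k).-1 < (m + n).-1)%N by lia.
  rewrite (leq_ltn_trans m1) ?lt_pred // (leq_ltn_trans m2) //.
  by rewrite [X in (_ < X.-1)%N]addnC lt_pred.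
have szv : (size v < size u)%N.
  rewrite szu (leq_ltn_trans (size_polyD _ _)) // gtn_max; apply/andP; split.
    rewrite -mulrA mul_polyC (leq_ltn_trans (size_scale_leq _ _)) //.
    rewrite (leq_ltn_trans (size_polyMleq _ _)) // size_polyXn /=.
    by rewrite !ltnS.
  by rewrite mul_polyC (leq_ltn_trans (size_scale_leq _ _)) // ltnS.
by rewrite -size_poly_gt0 size_polyDl // szu.
Qed.

(** Polynomial coefficients make the induction on [s] possible: eliminating a term turns even
    constant coefficients into polynomials. *)
Lemma expi_poly_indep (T : eqType) (s : seq T) (e e' : T -> R -> R[i])
    (a b : T -> R[i]) (p : T -> {poly R[i]}) :
  uniq s -> {in s &, injective a} -> (forall z t, e z t != 0) ->
  (forall z, is_cderive (e z) (e' z)) ->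
  (forall z t, expi t * e' z t = (a z * expi t ^+ 2 + b z) * e z t) ->
  (forall t, \sum_(z <- s) (p z).[expi t] * e z t = 0) ->
  {in s, forall z, p z = 0}.
Proof.
move=> us ainj en0 de eE.
have dw : is_cderive (@expi R) (fun t => 'i%C * expi t).
  have h t : is_derive t (1 : R) id (1 : R) by exact: is_derive_id.
  exact: is_cderive_expi h.
elim: s us ainj p => [//|z0 s IH] /= /andP[z0s us] ainj p rel.
(* Differentiate the relation and multiply by [expi t]. *)
have rel' t : \sum_(z <- z0 :: s) (twisted_deriv (a z) (b z) (p z)).[expi t] * e z t = 0.
  have := @is_cderive_sum _ _ (z0 :: s) _ _
    (fun z => is_cderiveM (is_cderive_horner (p z) dw) (de z)).
  move=> /is_cderive_ext /(_ rel (fun=> erefl)).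
  move=> /is_cderive_unique /(_ (is_cderive_cst 0)) /(_ t) D.
  have /= := congr1 (fun x => expi t * x) D; rewrite mulr0 => {}D.
  rewrite -[RHS]D mulr_sumr; apply: eq_bigr => z _.
  by rewrite mulrDr [_ * (_ * e' z t)]mulrCA eE horner_twisted_deriv; ring.
have [p00|p0n0] := eqVneq (p z0) 0.
  move=> z; rewrite inE => /predU1P[->//|]; apply: IH z => //.
    by move=> x y xs ys; apply: ainj; rewrite inE (xs, ys) orbT.
  by move=> t; have := rel t; rewrite big_cons p00 horner0 mul0r add0r.
have ps : {in s, forall z, p z = 0}.
  (* Cross-multiplying [rel] and [rel'] cancels the [z0] term, so the induction hypothesis gives
     [q z = 0] on [s]; by the degree comparison this forces [p z = 0]. *)
  pose q z := p z0 * twisted_deriv (a z) (b z) (p z) -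
    p z * twisted_deriv (a z0) (b z0) (p z0).
  move=> z zs; apply/eqP/negP => /negP pz; have : q z = 0.
    apply: IH zs => //.
      by move=> x y xs ys; apply: ainj; rewrite inE (xs, ys) orbT.
    move=> t.
    have -> : \sum_(j <- s) (q j).[expi t] * e j t =
              \sum_(j <- z0 :: s) (q j).[expi t] * e j t.
      by rewrite big_cons /q subrr horner0 mul0r add0r.
    transitivity ((p z0).[expi t] *
        \sum_(z <- z0 :: s) (twisted_deriv (a z) (b z) (p z)).[expi t] * e z t -
      (twisted_deriv (a z0) (b z0) (p z0)).[expi t] *
        \sum_(z <- z0 :: s) (p z).[expi t] * e z t).
      rewrite !mulr_sumr -sumrB; apply: eq_bigr => j _.
      by rewrite /q !(hornerM, hornerD, hornerN); ring.
    by rewrite rel rel' !mulr0 subrr.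
  apply/eqP/twisted_deriv_wronskian_neq0 => //.
  apply: contra_neq (_ : z != z0) => [h|]; last by apply: contraNneq z0s => <-.
  by apply: ainj h; rewrite inE ?eqxx ?zs ?orbT.
(* Only the [z0] term of the relation is left, and [e z0] never vanishes. *)
suff p0 : p z0 = 0 by rewrite p0 eqxx in p0n0.
apply: poly_expi_eq0 => t; have := rel t.
rewrite big_cons big_seq big1 => [|z zs]; last by rewrite ps // horner0 mul0r.
by rewrite addr0 => /eqP; rewrite mulf_eq0 (negPf (en0 _ _)) orbF => /eqP.
Qed.

(** With w = e^{it}, cos t = (w + 1/w)/2 and sin t = (w - 1/w)/(2i), whence w i (h cos t - g sin t)
    = (-g + ih)/2 w^2 + (g + ih)/2. The real part -g/2 keeps the leading constants distinct. *)
Lemma plane_wave_circle_indep (T : eqType) (s : seq T) (g h : T -> R)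
    (c : T -> R[i]) :
  uniq s -> {in s &, injective g} ->
  (forall t, \sum_(z <- s) c z * expi (g z * cos t + h z * sin t) = 0) ->
  {in s, forall z, c z = 0}.
Proof.
move=> us ginj rel z zs; apply/eqP; rewrite -polyC_eq0; apply/eqP.
pose e (z : T) (t : R) : R[i] := expi (g z * cos t + h z * sin t).
apply: (@expi_poly_indep _ s e
  (fun z t => (h z * cos t - g z * sin t) *i * e z t)
  (fun z => (- (g z / 2)) +i* (h z / 2)) (fun z => (g z / 2) +i* (h z / 2))
  (fun z => (c z)%:P)) zs => //.
- move=> x y xs ys [] /oppr_inj/mulIf gxy _; apply: ginj => //; apply: gxy.
  by rewrite invr_eq0 pnatr_eq0.
- by move=> x t; exact: expi_neq0.
- move=> x; apply: is_cderive_expi => t.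
  apply: (is_derive_eq (is_deriveD
    (is_deriveM (is_derive_cst (g x) t 1) (is_derive_cos t))
    (is_deriveM (is_derive_cst (h x) t 1) (is_derive_sin t)))).
  by rewrite /GRing.scale /=; ring.
- move=> x t; rewrite mulrA; congr (_ * _).
  have cs := cos2Dsin2 t.
  (* Applied to the constant term, this makes both sides quadratic forms in cos t and sin t. *)
  have pythagoras u : u = (cos t ^+ 2 + sin t ^+ 2) * u by rewrite cs mul1r.
  apply/eqP; rewrite eq_complex expr2 complexReD complexImD !(complexReM, complexImM) /=.
  apply/andP; split; apply/eqP.
    by rewrite [X in _ = _ + X]pythagoras; field.
  by rewrite [X in _ = _ + X]pythagoras; field.
- by move=> t; under eq_bigr do rewrite hornerC; exact: rel.
Qed.

End Independence.

(** * Plane waves on a sphere *)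

Section PlaneWaves.
Set Implicit Arguments.
Unset Strict Implicit.
Context {R : realType}.

Lemma dotvC d (x y : 'rV[R]_d) : dotv x y = dotv y x.
Proof. by apply: eq_bigr => i _; rewrite mulrC. Qed.

Lemma dotvDl d (x y z : 'rV[R]_d) : dotv (x + y) z = dotv x z + dotv y z.
Proof. by rewrite -big_split; apply: eq_bigr => i _; rewrite mxE mulrDl. Qed.

Lemma dotvZl d a (x z : 'rV[R]_d) : dotv (a *: x) z = a * dotv x z.
Proof. by rewrite mulr_sumr; apply: eq_bigr => i _; rewrite mxE mulrA. Qed.

Lemma dotvNl d (x z : 'rV[R]_d) : dotv (- x) z = - dotv x z.
Proof. by rewrite -scaleN1r dotvZl mulN1r. Qed.

Lemma dotv_gt0 d (x : 'rV[R]_d) i : x 0 i != 0 -> 0 < dotv x x.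
Proof.
move=> xi; rewrite /dotv (bigD1 i) //= ltr_pwDl //.
  by rewrite -expr2 lt_def sqrf_eq0 xi sqr_ge0.
by apply: sumr_ge0 => j _; rewrite -expr2 sqr_ge0.
Qed.

Lemma dotv_normalize d (x : 'rV[R]_d) : 0 < dotv x x ->
  let u := (enorm x)^-1 *: x in dotv u u = 1.
Proof.
move=> x0; rewrite /= dotvZl dotvC dotvZl mulrA -invfM -expr2 sqr_sqrtr ?ltW //.
by rewrite mulVf ?gt_eqF.
Qed.

(* The first vector points along the moment curve (1, t, t^2, ...), which meets
   each of the finitely many hyperplanes orthogonal to some x - y in finitely
   many points. *)
Lemma separating_frame d (s : seq 'rV[R]_d.+2) : exists u v : 'rV[R]_d.+2,
  [/\ dotv u u = 1, dotv v v = 1, dotv u v = 0 & {in s &, injective (dotv u)}].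
Proof.
(* The value of [P z] at t is the inner product of z with (1, t, t^2, ...). *)
pose P (z : 'rV[R]_d.+2) : {poly R} := \poly_(i < d.+2) z 0 (inord i).
have P0 z : z != 0 -> P z != 0.
  apply: contra_neq => Pz; apply/rowP => i; rewrite mxE.
  have := congr1 (fun p : {poly R} => p`_i) Pz.
  by rewrite coef_poly ltn_ord inord_val coef0.
pose D := [seq x - y | x <- s, y <- s].
have Q0 : \prod_(z <- D | z != 0) P z != 0.
  by rewrite prodf_seq_neq0; apply/allP => z _; apply/implyP => /P0.
have [t tD] : exists t, (\prod_(z <- D | z != 0) P z).[t] != 0.
  apply: contrapT => /forallNP h; move/eqP: Q0; apply.
  apply: (@poly_inj_roots_eq0 _ _ (fun k => k%:R)) => [k l /eqP|k].
    by rewrite eqr_nat => /eqP.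
  by apply/eqP/negPn/negP/h.
(* The vector (-t, 1, 0, ...) is orthogonal to (1, t, t^2, ...). *)
pose u : 'rV[R]_d.+2 := \row_i t ^+ i.
pose v : 'rV[R]_d.+2 := \row_i (if i == 0 then - t else if i == 1 then 1 else 0).
have u0 : 0 < dotv u u by apply: (@dotv_gt0 _ _ 0); rewrite mxE expr0 oner_eq0.
have v0 : 0 < dotv v v by apply: (@dotv_gt0 _ _ 1); rewrite mxE /= oner_eq0.
exists ((enorm u)^-1 *: u), ((enorm v)^-1 *: v); split.
- exact: dotv_normalize.
- exact: dotv_normalize.
- rewrite dotvZl dotvC dotvZl /dotv !big_ord_recl big1 => [|i _]; rewrite !mxE //=.
    by rewrite /bump /=; ring.
  by rewrite mul0r.
- move=> x y xs ys /eqP; rewrite !dotvZl -subr_eq0 -mulrBr mulf_eq0 invr_eq0.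
  rewrite gt_eqF ?sqrtr_gt0 //= -mulN1r ![dotv u _]dotvC -dotvZl -dotvDl scaleN1r.
  move=> /eqP xy; apply/eqP; rewrite -subr_eq0; apply: contraT => xy0.
  move: tD; rewrite horner_prod prodf_seq_neq0 => /allP.
  move=> /(_ (x - y) (allpairs_f (fun x y => x - y) xs ys)).
  rewrite xy0 /= horner_poly => /eqP[].
  by rewrite -[RHS]xy; apply: eq_bigr => i _; rewrite !mxE inord_val.
Qed.

(** Restrict to the great circle l = kappa (cos t u + sin t v) of a separating frame. *)
Lemma plane_wave_sphere_indep d (kappa : R) (s : seq 'rV[R]_d.+2)
    (c : 'rV[R]_d.+2 -> R[i]) :
  0 < kappa -> uniq s ->
  (forall l, esphere kappa l -> \sum_(z <- s) c z * expi (dotv l z) = 0) ->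
  {in s, forall z, c z = 0}.
Proof.
move=> k0 us rel; have [u [v [uu vv uv uinj]]] := separating_frame s.
apply: (@plane_wave_circle_indep _ _ s (fun z => kappa * dotv u z)
  (fun z => kappa * dotv v z)) => //.
  by move=> x y xs ys /mulfI xy; apply: uinj => //; apply: xy; rewrite gt_eqF.
move=> t; rewrite -[RHS](rel (kappa *: (cos t *: u + sin t *: v))).
  by apply: eq_bigr => z _; rewrite !(dotvZl, dotvDl); congr (_ * expi _); ring.
rewrite /esphere /= /enorm dotvZl dotvC dotvZl !(dotvDl, dotvZl).
rewrite ![dotv _ (_ + _)]dotvC !(dotvDl, dotvZl) uu vv uv [dotv v u]dotvC uv.
rewrite (_ : kappa * _ = kappa ^+ 2 * (cos t ^+ 2 + sin t ^+ 2)); last by ring.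
by rewrite cos2Dsin2 mulr1 sqrtr_sqr gtr0_norm.
Qed.

(** Points may repeat, so only the total coefficient at each point vanishes. This allows merging two
    families with common points. *)
Lemma plane_wave_family_indep d (kappa : R) (I : finType) (y : I -> 'rV[R]_d.+2)
    (c : I -> R[i]) :
  0 < kappa ->
  (forall l, esphere kappa l -> \sum_i c i * expi (dotv l (y i)) = 0) ->
  forall z, \sum_(i | y i == z) c i = 0.
Proof.
move=> k0 rel z; have [zy|zy] := boolP (z \in undup (codom y)); last first.
  rewrite big_pred0 // => i; apply: contraNF zy => /eqP <-.
  by rewrite mem_undup codom_f.
apply: (@plane_wave_sphere_indep _ kappa (undup (codom y))
  (fun z => \sum_(i | y i == z) c i)) zy => //; first exact: undup_uniq.
move=> l /rel relE; rewrite -[RHS]relE; under eq_bigr do rewrite mulr_suml.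
rewrite (exchange_big_dep predT) //=; apply: eq_bigr => i _.
rewrite big_mkcond (bigD1_seq (y i)) ?undup_uniq ?mem_undup ?codom_f //= eqxx.
by rewrite big1 ?addr0 // => x xy; rewrite eq_sym (negPf xy).
Qed.

(** Independence for the disjoint union of the families, the second with negated coefficients. *)
Lemma plane_wave_family_eq d (kappa : R) (I J : finType) (y : I -> 'rV[R]_d.+2)
    (y' : J -> 'rV[R]_d.+2) (c : I -> R[i]) (c' : J -> R[i]) :
  0 < kappa ->
  (forall l, esphere kappa l ->
    \sum_i c i * expi (dotv l (y i)) = \sum_j c' j * expi (dotv l (y' j))) ->
  forall z, \sum_(i | y i == z) c i = \sum_(j | y' j == z) c' j.
Proof.
move=> k0 rel z; apply/eqP; rewrite -subr_eq0 -sumrN; apply/eqP.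
pose yy (k : I + J) := match k with inl i => y i | inr j => y' j end.
pose cc (k : I + J) := match k with inl i => c i | inr j => - c' j end.
have := @plane_wave_family_indep _ kappa (I + J)%type yy cc k0 _ z.
rewrite big_sumType; apply => l /rel relE; rewrite big_sumType /= relE -big_split.
by apply: big1 => j _ /=; rewrite mulNr subrr.
Qed.

(** Compare coefficients in one variable at a time: those of the waves in k are compared for fixed
    z, which reduces to comparing those of the waves in l for each fixed k. *)
Lemma plane_wave_form_eq d (kappa : R) (n n' : nat) (y : 'I_n -> 'rV[R]_d.+2)
    (y' : 'I_n' -> 'rV[R]_d.+2) (M : 'M[R[i]]_n) (M' : 'M[R[i]]_n') :
  0 < kappa ->
  (forall k l, esphere kappa k -> esphere kappa l ->
    \sum_i (\sum_j M i j * expi (dotv k (y j))) * expi (dotv l (y i)) =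
    \sum_i (\sum_j M' i j * expi (dotv k (y' j))) * expi (dotv l (y' i))) ->
  forall z w, \sum_(i | y i == z) \sum_(j | y j == w) M i j =
              \sum_(i | y' i == z) \sum_(j | y' j == w) M' i j.
Proof.
move=> k0 rel z w; rewrite exchange_big [RHS]exchange_big /=.
apply: (@plane_wave_family_eq _ kappa _ _ y y') => // k kS.
under eq_bigr do rewrite mulr_suml.
under [RHS]eq_bigr do rewrite mulr_suml.
rewrite exchange_big [RHS]exchange_big /=.
by apply: (@plane_wave_family_eq _ kappa _ _ y y') => // l; apply: rel.
Qed.

End PlaneWaves.

(** * Recovering the potential from the amplitude *)

Section Reconstruction.
Set Implicit Arguments.
Unset Strict Implicit.

Lemma unitmx_row_neq0 (F : fieldType) n (M : 'M[F]_n) (i : 'I_n) :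
  M \in unitmx -> exists j, M i j != 0.
Proof.
move=> uM; apply: contrapT => /forallNP h.
have : (M *m invmx M) i i = 0.
  by rewrite mxE big1 // => j _; have /negP/negPn/eqP -> := h j; rewrite mul0r.
by rewrite mulmxV // mxE eqxx => /eqP; rewrite oner_eq0.
Qed.

(** Injectivity of [y] reduces the left sum at ([y i], [y j]) to [M i j], nonzero for some j; were
    [y i] not a value of [y'], the right sum would be empty. *)
Lemma support_form_sub (F : fieldType) (T : eqType) n n' (y : 'I_n -> T)
    (y' : 'I_n' -> T) (M : 'M[F]_n) (M' : 'M[F]_n') :
  injective y -> M \in unitmx ->
  (forall z w, \sum_(i | y i == z) \sum_(j | y j == w) M i j =
               \sum_(i | y' i == z) \sum_(j | y' j == w) M' i j) ->
  forall i, exists j, y' j = y i.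
Proof.
move=> yinj uM MM' i; have [j Mij] := unitmx_row_neq0 i uM.
apply: contrapT => /forallNP h; move/eqP: Mij; apply.
have := MM' (y i) (y j); rewrite (big_pred1 i) => [|k]; last by rewrite inj_eq.
rewrite (big_pred1 j) => [->|k]; last by rewrite inj_eq.
by rewrite big_pred0 // => k; apply/eqP/h.
Qed.

Context {R : realType}.

Lemma scatc_neq0 d (kappa : R) : 0 < kappa -> scatc d kappa != 0.
Proof.
move=> k0; rewrite /scatc !mulf_neq0 ?expf_neq0 ?mulf_neq0 ?expi_neq0 //.
- by rewrite oppr_eq0 eq_complex /= eqxx gt_eqF ?pi_gt0.
- by rewrite eq_complex /= eqxx andbT gt_eqF // sqrtr_gt0 mulr_gt0 ?pi_gt0.
- by rewrite eq_complex /= eqxx andbT gt_eqF // powR_gt0.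
Qed.

Lemma scatqE d n (y : 'I_n -> 'rV[R]_d) (alpha : 'I_n -> R[i]) (kappa : R)
    (k : 'rV[R]_d) i :
  scatq y alpha kappa k i 0 =
  - \sum_j invmx (scatA y alpha kappa) i j * expi (dotv k (y j)).
Proof.
by rewrite /scatq mulmxN !mxE; congr (- _); apply: eq_bigr => j _; rewrite mxE.
Qed.

(** Taking -l, which stays on the sphere, gives the waves in k and l the same sign. *)
Lemma scat_amplitude_form d n (y : 'I_n -> 'rV[R]_d) (alpha : 'I_n -> R[i])
    (kappa : R) (k l : 'rV[R]_d) :
  scat_amplitude y alpha kappa k (- l) =
  - (scatc d kappa / ((2 * pi) ^+ d)%:C) *
  \sum_i (\sum_j invmx (scatA y alpha kappa) i j * expi (dotv k (y j)))
         * expi (dotv l (y i)).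
Proof.
rewrite /scat_amplitude mulNr -mulrN -sumrN; congr (_ * _).
by apply: eq_bigr => i _; rewrite scatqE dotvNl opprK mulNr.
Qed.

(** The term subtracted from the strength depends only on [d] and [kappa], so it cancels. *)
Lemma scatA_diag_inj d n n' (y : 'I_n -> 'rV[R]_d) (alpha : 'I_n -> R[i])
    (y' : 'I_n' -> 'rV[R]_d) (alpha' : 'I_n' -> R[i]) (kappa : R) i i' :
  scatA y alpha kappa i i = scatA y' alpha' kappa i' i' -> alpha i = alpha' i'.
Proof. by rewrite !mxE !eqxx; case: ifP => _ /addIr. Qed.

End Reconstruction.

Theorem theorem3p1 (R : realType) (d : nat) (hd : d = 2%N \/ d = 3%N)
  (E kappa : R) (hE : 0 < E) (hkappa : kappa = Num.sqrt E)
  (n n' : nat)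
  (y : 'I_n -> 'rV[R]_d) (alpha : 'I_n -> R[i])
  (y' : 'I_n' -> 'rV[R]_d) (alpha' : 'I_n' -> R[i])
  (hy : injective y) (hy' : injective y')
  (hA : \det (scatA y alpha kappa) != 0)
  (hA' : \det (scatA y' alpha' kappa) != 0)
  (hf : forall k l : 'rV[R]_d,
      esphere kappa k -> esphere kappa l ->
      scat_amplitude y alpha kappa k l = scat_amplitude y' alpha' kappa k l) :
  potential y alpha = potential y' alpha' /\ n = n'.
Proof.
have k0 : 0 < kappa by rewrite hkappa sqrtr_gt0.
have [d' dE] : exists d', d = d'.+2 by case: hd => ->; [exists 0%N|exists 1%N].
subst d; clear hd.
set A := scatA y alpha kappa in hA *; set A' := scatA y' alpha' kappa in hA' *.
have uA : A \in unitmx by rewrite unitmxE unitfE.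
have uA' : A' \in unitmx by rewrite unitmxE unitfE.
have forms : forall z w,
    \sum_(i | y i == z) \sum_(j | y j == w) invmx A i j =
    \sum_(i | y' i == z) \sum_(j | y' j == w) invmx A' i j.
  apply: (@plane_wave_form_eq _ _ kappa) => // k l kS lS.
  have lS' : esphere kappa (- l).
    by rewrite /esphere /= /enorm dotvNl dotvC dotvNl opprK.
  have := hf k (- l) kS lS'; rewrite !scat_amplitude_form => /mulfI; apply.
  rewrite oppr_eq0 mulf_neq0 ?scatc_neq0 // invr_eq0 eq_complex /= eqxx andbT.
  by rewrite expf_neq0 // mulf_neq0 ?pnatr_eq0 // gt_eqF ?pi_gt0.
have uM : invmx A \in unitmx by rewrite unitmx_inv.
have uM' : invmx A' \in unitmx by rewrite unitmx_inv.
(* [s] and [t] match the indices of equal points; injectivity of [y] and [y'] makes them mutually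
   inverse. *)
have [s sE] := choice (support_form_sub hy uM forms).
have [t tE] := choice (support_form_sub hy' uM' (fun z w => esym (forms z w))).
have sK : cancel s t by move=> i; apply: hy; rewrite tE sE.
have tK : cancel t s by move=> i; apply: hy'; rewrite sE tE.
have MM' i j : invmx A i j = invmx A' (s i) (s j).
  have := forms (y i) (y j).
  rewrite (big_pred1 i) => [|k]; last by rewrite inj_eq.
  rewrite (big_pred1 j) => [->|k]; last by rewrite inj_eq.
  rewrite (big_pred1 (s i)) => [|k]; last by rewrite -sE inj_eq.
  by rewrite (big_pred1 (s j)) // => k; rewrite -sE inj_eq.
(* Reindexed along [s], [A'] is a left inverse of [invmx A], hence equals [A]. *)
have AA' i j : A i j = A' (s i) (s j).
  pose B := \matrix_(i, j) A' (s i) (s j).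
  have BM : B *m invmx A = 1%:M.
    apply/matrixP => p q; have /matrixP/(_ (s p) (s q)) := mulmxV uA'.
    rewrite !mxE (inj_eq (can_inj sK)) => <-.
    rewrite (reindex s); last by exists t => x _; [exact: sK|exact: tK].
    by apply: eq_bigr => r _; rewrite mxE MM'.
  have -> : A = B by rewrite -[B](mulmxKV uA) BM mul1mx.
  by rewrite mxE.
have alphaE i : alpha i = alpha' (s i) by apply: scatA_diag_inj (AA' i i).
split; last by rewrite -[n]card_ord -[n']card_ord; apply: bij_eq_card; exists t.
apply/seteqP; split=> _ [i _ <-].
  by exists (s i); rewrite // sE alphaE.
by exists (t i); rewrite // tE alphaE tK.
Qed.
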